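(* Let $d,n\in\mathbb{N}$, $d,n\ge 1$, $h=1/n$, $N=2n$, $c>0$, and let $A_h^D\in\mathbb{R}^{(n-1)^d\times(n-1)^d}$, $A_h^P\in\mathbb{R}^{N^d\times N^d}$ be the Dirichlet and periodic matrices and $E_{o,h}$ the odd extension operator defined in the context. Let $B_h^D\in\mathbb{R}^{(n-1)^d\times(n-1)^d}$ and $B_h^P\in\mathbb{R}^{N^d\times N^d}$ be linear operators such that $(B_h^D,B_h^P)$ is an LFA-compatible pair. Let $\bm{f}\in\mathbb{R}^{(n-1)^d}$ and $\widetilde{\bm{f}}=E_{o,h}^{\otimes d}\bm{f}$. Given initial vectors $\bm{u}^0\in\mathbb{R}^{(n-1)^d}$ and $\widetilde{\bm{u}}^0\in\mathbb{R}^{N^d}$, define for $k=0,1,2,\ldots$ $$\bm{u}^{k+1}=\bm{u}^k+B_h^D(\bm{f}-A_h^D\bm{u}^k),\qquad \widetilde{\bm{u}}^{k+1}=\widetilde{\bm{u}}^k+B_h^P(\widetilde{\bm{f}}-A_h^P\widetilde{\bm{u}}^k).$$ If $\widetilde{\bm{u}}^0=E_{o,h}^{\otimes d}\bm{u}^0$, then $\widetilde{\bm{u}}^k=E_{o,h}^{\otimes d}\bm{u}^k$ for all $k=1,2,\ldots$.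
   Context: Let $\bm{e}_k^m$ be the $k$-th canonical basis vector of $\mathbb{R}^m$, $I_m$ the $m\times m$ identity, $\otimes$ the Kronecker (tensor) product of matrices, and $X^{\otimes k}$ the $k$-fold tensor power of $X$. Let $\operatorname{diag}(-1,2,-1)$ denote the square tridiagonal matrix (of the indicated size) with $2$ on the diagonal and $-1$ on the sub- and superdiagonals. Fix $h=1/n$, $N=2n$, $c>0$. Dirichlet matrix: $T_h^D=\frac{1}{h^2}\operatorname{diag}(-1,2,-1)\in\mathbb{R}^{(n-1)\times(n-1)}$ and $$A_h^D=\sum_{j=1}^d\left(I_{n-1}^{\otimes(j-1)}\otimes T_h^D\otimes I_{n-1}^{\otimes(d-j)}\right)+c\,I_{n-1}^{\otimes d}.$$ Periodic matrix: $T_h^P=\frac{1}{h^2}\left(\operatorname{diag}(-1,2,-1)-\bm{e}_1^N(\bm{e}_N^N)^T-\bm{e}_N^N(\bm{e}_1^N)^T\right)\in\mathbb{R}^{N\times N}$ and $$A_h^P=\sum_{j=1}^d\left(I_N^{\otimes(j-1)}\otimes T_h^P\otimes I_N^{\otimes(d-j)}\right)+c\,I_N^{\otimes d}.$$ Odd extension operator: the linear map $E_{o,h}:\mathbb{R}^{n-1}\to\mathbb{R}^N$ with $E_{o,h}\bm{e}_i^{n-1}=\bm{e}_i^N-\bm{e}_{N-i}^N$, $i=1,\ldots,n-1$. Restriction operator: $R_{o,h}=\frac12E_{o,h}^T$. In dimension $d$ the extension and restriction operators are $E_{o,h}^{\otimes d}$ and $R_{o,h}^{\otimes d}$. LFA-compatibility: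 a pair $(M_h^D,M_h^P)$ with $M_h^D\in\mathbb{R}^{(n-1)^d\times(n-1)^d}$ and $M_h^P\in\mathbb{R}^{N^d\times N^d}$ is LFA-compatible if and only if $M_h^D=R_{o,h}^{\otimes d}M_h^PE_{o,h}^{\otimes d}$ and $M_h^P\bm{v}\in\operatorname{range}(E_{o,h}^{\otimes d})$ for all $\bm{v}\in\operatorname{range}(E_{o,h}^{\otimes d})$. If $n=1$, $\mathbb{R}^{n-1}$ is the zero space. *)

(* Defs.v *)
From mathcomp Require Import all_boot all_order all_algebra.
From mathcomp Require Import reals.
From mathcomp.real_closed Require Export mxtens.

Set Implicit Arguments.
Unset Strict Implicit.
Unset Printing Implicit Defensive.

Import GRing.Theory Num.Theory.
Local Open Scope ring_scope.

(* Tensor products [A *t B] and tensor powers [A ^t k] (with [A ^t 0 = 1], of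
   size 1) are those of [mxtens]. Row and column indices of matrices start at
   0, so the 1-based index k of the mathematics is the ordinal of value k - 1. *)

Section LFA.
Variable R : realType.

(* The 1-based canonical vector e_k^m, for 1 <= k <= m. *)
Definition evec (m k : nat) : 'cV[R]_m := \col_(i < m) (i.+1 == k)%:R.

Definition tridiag (m : nat) (a b c : R) : 'M[R]_m :=
  \matrix_(i < m, j < m)
    if i == j :> nat then b
    else if i == j.+1 :> nat then a
    else if j == i.+1 :> nat then c
    else 0.

Lemma kron_dim (m d : nat) (j : 'I_d) :
  (m ^ j * m * m ^ (d - j.+1) = m ^ d)%N.
Proof. by rewrite -expnSr -expnD subnKC. Qed.

(* [kron_at T j] is I^{(x) j} (x) T (x) I^{(x) (d - 1 - j)}; the cast only
   identifies m^j * m * m^(d-1-j) with m^d. *)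
Definition kron_at (m d : nat) (T : 'M[R]_m) (j : 'I_d) : 'M[R]_(m ^ d) :=
  castmx (kron_dim m j, kron_dim m j)
    ((1%:M : 'M[R]_m) ^t j *t T *t (1%:M : 'M[R]_m) ^t (d - j.+1)).

Definition kron_sum (m d : nat) (T : 'M[R]_m) (c : R) : 'M[R]_(m ^ d) :=
  (\sum_(j < d) kron_at T j) + c *: (1%:M : 'M[R]_m) ^t d.

Definition mesh (n : nat) : R := 1 / n%:R.

Definition T_D (n : nat) : 'M[R]_(n.-1) :=
  (1 / mesh n ^+ 2) *: tridiag n.-1 (-1) 2 (-1).

(* For n = 1 the corner terms fall on the off-diagonal of the 2 x 2 matrix and
   add up with it. *)
Definition T_P (n : nat) : 'M[R]_(2 * n) :=
  let N := (2 * n)%N in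
  (1 / mesh n ^+ 2) *:
    (tridiag N (-1) 2 (-1) - evec N 1 *m (evec N N)^T
                           - evec N N *m (evec N 1)^T).

Definition A_D (n d : nat) (c : R) : 'M[R]_(n.-1 ^ d) := kron_sum d (T_D n) c.

Definition A_P (n d : nat) (c : R) : 'M[R]_((2 * n) ^ d) :=
  kron_sum d (T_P n) c.

(* The matrix whose 1-based column i is e_i^N - e_{N-i}^N, with N = 2n. *)
Definition odd_ext (n : nat) : 'M[R]_(2 * n, n.-1) :=
  \matrix_(r < (2 * n)%N, i < n.-1)
    (evec (2 * n) i.+1 - evec (2 * n) (2 * n - i.+1)) r 0.

Definition odd_restr (n : nat) : 'M[R]_(n.-1, 2 * n) :=
  (1 / 2) *: (odd_ext n)^T.

Definition in_range (p q : nat) (A : 'M[R]_(p, q)) (v : 'cV[R]_p) : Prop :=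
  exists x : 'cV[R]_q, v = A *m x.

Definition LFA_compatible (n d : nat)
    (MD : 'M[R]_(n.-1 ^ d)) (MP : 'M[R]_((2 * n) ^ d)) : Prop :=
  MD = odd_restr n ^t d *m MP *m odd_ext n ^t d /\
  forall v : 'cV[R]_((2 * n) ^ d),
    in_range (odd_ext n ^t d) v -> in_range (odd_ext n ^t d) (MP *m v).

End LFA.

Arguments odd_ext R n : clear implicits.
Arguments odd_restr R n : clear implicits.
Arguments LFA_compatible {R} n d MD MP.

(* Main.v *)
(* Write E for the odd extension and X^d for the d-fold tensor power of X. A
   direct computation gives T_P E = E T_D, hence A_P E^d = E^d A_D factor by
   factor in the tensor products. Since R_o E = 1, LFA-compatibility gives
   B_P E^d = E^d B_D: any B_P E^d x is of the form E^d y, and E^d R_o^d fixes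
   E^d y. So E^d intertwines the two iterations. *)

Require Import Defs.
From mathcomp Require Import all_boot all_order all_algebra.
From mathcomp Require Import reals.
From mathcomp Require Import zify ring.

Set Implicit Arguments.
Unset Strict Implicit.
Unset Printing Implicit Defensive.

Import GRing.Theory Num.Theory.
Local Open Scope ring_scope.

Lemma castmx_mulmx (R : pzRingType) m m' n n' p p'
    (em : m = m') (en : n = n') (ep : p = p')
    (A : 'M[R]_(m, n)) (B : 'M[R]_(n, p)) :
  castmx (em, en) A *m castmx (en, ep) B = castmx (em, ep) (A *m B).
Proof. by case: m' / em; case: n' / en; case: p' / ep; rewrite !castmx_id. Qed.

(** Both bracketings split an index into the same three mixed-radix digits; the three div-mod
    identities match them one by one. *)
Lemma tensmxA (R : pzRingType) m n p q r s
    (A : 'M[R]_(m, n)) (B : 'M[R]_(p, q)) (C : 'M[R]_(r, s)) :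
  A *t B *t C = castmx (mulnA m p r, mulnA n q s) (A *t (B *t C)).
Proof.
have div_div a b c : (a %/ (b * c) = a %/ c %/ b)%N by rewrite mulnC divnMA.
have mod_div a b c : ((a %% (b * c)) %/ c = a %/ c %% b)%N by rewrite modn_divl.
have mod_mod a b c : (a %% (b * c) %% c = a %% c)%N
  by rewrite modn_dvdm ?dvdn_mull.
apply/matrixP => i j; rewrite castmxE !mxE -mulrA.
by congr (A _ _ * (B _ _ * C _ _)); apply: val_inj => /=;
  rewrite ?div_div ?mod_div ?mod_mod.
Qed.

Lemma ntensmx_recl (R : comPzRingType) m n (A : 'M[R]_(m, n)) k :
  A ^t k.+1 = castmx (esym (expnS m k), esym (expnS n k)) (A *t A ^t k).
Proof.
case: k => [|k]; last first.
  by rewrite ntensmxSS; apply/matrixP => i j; rewrite castmxE !cast_ord_id.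
rewrite ntensmx0 ntensmx1 (tens_mx_scalar 1 A) castmx_comp scale1r.
by apply/matrixP => i j; rewrite castmxE !cast_ord_id.
Qed.

Lemma castmx_tensl (R : pzRingType) m m' n n' p q (em : m = m') (en : n = n')
    (A : 'M[R]_(m, n)) (B : 'M[R]_(p, q)) :
  castmx (em, en) A *t B =
  castmx (congr1 (muln^~ p) em, congr1 (muln^~ q) en) (A *t B).
Proof. by case: m' / em; case: n' / en; rewrite !castmx_id. Qed.

Lemma castmx_tensr (R : pzRingType) m m' n n' p q (em : m = m') (en : n = n')
    (A : 'M[R]_(m, n)) (B : 'M[R]_(p, q)) :
  B *t castmx (em, en) A =
  castmx (congr1 (muln p) em, congr1 (muln q) en) (B *t A).
Proof. by case: m' / em; case: n' / en; rewrite !castmx_id. Qed.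

Lemma ntensmxD (R : comPzRingType) m n (A : 'M[R]_(m, n)) j k :
  A ^t (j + k) = castmx (esym (expnD m j k), esym (expnD n j k))
                        (A ^t j *t A ^t k).
Proof.
elim: j => [|j IHj].
  rewrite ntensmx0 tens_scalar1mx castmx_comp.
  by apply/matrixP => a b; rewrite castmxE !cast_ord_id.
rewrite (ntensmx_recl A (j + k)) IHj (ntensmx_recl A j).
rewrite castmx_tensr castmx_tensl tensmxA !castmx_comp.
by congr (castmx (_, _) _); apply: nat_irrelevance.
Qed.

Lemma ntensmx_mul (R : comPzRingType) m n p (A : 'M[R]_(m, n))
    (B : 'M[R]_(n, p)) k : A ^t k *m B ^t k = (A *m B) ^t k.
Proof.
elim: k => [|k IHk]; first by rewrite !ntensmx0 mul1mx.
by rewrite !ntensmx_recl castmx_mulmx tensmx_mul IHk.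
Qed.

(** Isolates factor [j] under the very casts of [kron_at], so that products with [kron_at] can be
    taken factor by factor. *)
Lemma ntensmx_split (R : comPzRingType) m n (A : 'M[R]_(m, n)) d (j : 'I_d) :
  A ^t d = castmx (kron_dim m j, kron_dim n j)
                  (A ^t j *t A *t A ^t (d - j.+1)).
Proof.
have ed : (j + 1 + (d - j.+1))%N = d by rewrite addn1 subnKC.
have cast_exp a b (e : a = b) :
    A ^t b = castmx (congr1 (expn m) e, congr1 (expn n) e) (A ^t a).
  by case: b / e; rewrite castmx_id.
rewrite (cast_exp _ _ ed) !ntensmxD ntensmx1 castmx_tensl !castmx_comp.
by congr (castmx (_, _) _); apply: nat_irrelevance.
Qed.

Lemma kron_at_intertwine (R : realType) m n (E : 'M[R]_(m, n)) (S : 'M[R]_m)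
    (T : 'M[R]_n) d (j : 'I_d) :
  S *m E = E *m T -> kron_at S j *m E ^t d = E ^t d *m kron_at T j.
Proof.
move=> SE; rewrite (ntensmx_split E j) /kron_at !castmx_mulmx !tensmx_mul.
by rewrite !ntensmx_mul !mul1mx !mulmx1 SE.
Qed.

Lemma kron_sum_intertwine (R : realType) m n (E : 'M[R]_(m, n)) (S : 'M[R]_m)
    (T : 'M[R]_n) d (c : R) :
  S *m E = E *m T -> kron_sum d S c *m E ^t d = E ^t d *m kron_sum d T c.
Proof.
move=> SE; rewrite /kron_sum mulmxDl mulmxDr mulmx_suml mulmx_sumr.
congr (_ + _); first by apply: eq_bigr => j _; apply: kron_at_intertwine.
by rewrite -scalemxAl -scalemxAr !ntensmx_mul mul1mx mulmx1.
Qed.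

(** [F] lives on [nat] so that [a] may fall outside the index range, where the sum is empty of
    nonzero terms. *)
Lemma sum_ord_delta (R : pzRingType) m (a : nat) (F : nat -> R) :
  \sum_(k < m) (k == a :> nat)%:R * F k = if (a < m)%N then F a else 0.
Proof.
case: ltnP => [lt_am | le_ma].
  rewrite (bigD1 (Ordinal lt_am)) //= eqxx mul1r big1 ?addr0 // => k.
  by rewrite -val_eqE /= => /negPf ->; rewrite mul0r.
rewrite big1 // => k _; case: eqP => [ek | _]; last by rewrite mul0r.
by have := ltn_ord k; rewrite ek ltnNge le_ma.
Qed.

Lemma odd_extE (R : realType) n r i :
  odd_ext R n r i = (r == i :> nat)%:R - (r == 2 * n - i.+2 :> nat)%N%:R.
Proof.
by rewrite !mxE eqSS; congr (_ - _%:R); have := ltn_ord i; lia.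
Qed.

(** Column [a] of the extension has entries 1 in row [a < n - 1] and -1 in the mirrored row
    [2n - a - 2 >= n], so distinct columns have disjoint supports and each has squared norm 2. *)
Lemma odd_restr_ext (R : realType) n : odd_restr R n *m odd_ext R n = 1%:M.
Proof.
apply/matrixP => i j; rewrite /odd_restr -scalemxAl !mxE.
under eq_bigr => k _ do rewrite mxE !odd_extE mulrBl.
pose F k : R := (k == j :> nat)%:R - (k == 2 * n - j.+2 :> nat)%N%:R.
rewrite sumrB (sum_ord_delta _ _ F) (sum_ord_delta _ _ F) /F -val_eqE /=.
have := ltn_ord i; have := ltn_ord j; move: (val i) (val j) => a b hb ha.
have -> : (a < 2 * n)%N by lia.
have -> : (2 * n - a.+2 < 2 * n)%N by lia.
have -> : (a == 2 * n - b.+2)%N = false by lia.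
have -> : (2 * n - a.+2 == b)%N = false by lia.
have -> : (2 * n - a.+2 == 2 * n - b.+2)%N = (a == b) by lia.
by case: (a == b) => /=; field.
Qed.

(** The periodic stencil preserves oddness, and odd vectors vanish in rows [n - 1] and [2n - 1],
    which act as the Dirichlet boundary. *)
Lemma T_P_odd_ext (R : realType) n :
  T_P R n *m odd_ext R n = odd_ext R n *m T_D R n.
Proof.
rewrite /T_P /T_D -scalemxAl -scalemxAr; congr (_ *: _).
apply/matrixP => r i; rewrite !mxE.
(* Up to the common factor, [F] is row [r] of [T_P] and [G] is column [i] of [T_D], extended to all
   naturals for [sum_ord_delta]. *)
pose t (a b : nat) : R :=
  if a == b then 2 else if a == b.+1 then -1 else if b == a.+1 then -1 else 0.
pose F (k : nat) : R := t r k - (r.+1 == 1)%N%:R * (k.+1 == 2 * n)%N%:R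
  - (r.+1 == 2 * n)%N%:R * (k.+1 == 1)%N%:R.
pose G (k : nat) : R := t k i.
transitivity (\sum_(k < 2 * n) ((k == i :> nat)%:R * F k
                - (k == 2 * n - i.+2 :> nat)%N%:R * F k)).
  apply: eq_bigr => k _; rewrite odd_extE -mulrBl mulrC; congr (_ * _).
  by rewrite !mxE !big_ord1 !mxE.
(* For the last row (r = 2n - 1) the index 2n - r - 2 would be truncated to 0, a
   valid column; [n] is a column index out of range. *)
transitivity (\sum_(k < n.-1) ((k == r :> nat)%:R * G k
    - (k == (if r.+2 <= 2 * n then 2 * n - r.+2 else n)%N :> nat)%:R * G k));
  last first.
  apply: eq_bigr => k _; rewrite odd_extE -mulrBl mxE eq_sym.
  by congr ((_ - _%:R) * _); have := ltn_ord k; case: ifP; lia.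
rewrite !sumrB !sum_ord_delta /F /G /t.
have := ltn_ord r; have := ltn_ord i; move: (val i) (val r) => b a hb ha /=.
have -> : (b < 2 * n)%N by lia.
have -> : (2 * n - b.+2 < 2 * n)%N by lia.
(* Neither nonzero row of column [b] is the last one, and the mirrored one is not row 0. Only the
   corner term pairing [a = 2n - 1] with [b = 0] survives. *)
have -> : (b.+1 == 2 * n)%N = false by lia.
have -> : ((2 * n - b.+2).+1 == 2 * n)%N = false by lia.
have -> : ((2 * n - b.+2).+1 == 1)%N = false by lia.
rewrite !eqSS !mulr0 !subr0.
(* Last row: the right side is 0; on the left, for [b = 0], the corner entry cancels the neighbour
   [2n - 2]. *)
have [e2n|ne2n] := eqVneq a.+1 (2 * n)%N.
  have -> : (a.+1 < 2 * n)%N = false by lia.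
  have -> : (a < n.-1)%N = false by lia.
  rewrite [(n < n.-1)%N]ltnNge leq_pred mul1r /=.
  by do ![case: eqP => ?; try lia]; rewrite /=; ring.
have -> : (a.+1 < 2 * n)%N by lia.
rewrite mul0r subr0.
(* Above the middle row [n - 1], the stencil does not reach the mirrored entry. *)
have [la|ga] := ltnP a n.-1.
  have -> : (2 * n - a.+2 < n.-1)%N = false by lia.
  by do ![case: eqP => ?; try lia].
(* Below the middle row, the mirror image of the previous case; in the middle row itself, the
   contributions of [n - 2] and [n] cancel. *)
have [la|ga'] := ltnP (2 * n - a.+2) n.-1; do ![case: eqP => ?; try lia]; ring.
Qed.

Lemma LFA_compatible_intertwine (R : realType) n d (BD : 'M[R]_(n.-1 ^ d))
    (BP : 'M[R]_((2 * n) ^ d)) (x : 'cV[R]_(n.-1 ^ d)) :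
  LFA_compatible n d BD BP ->
  BP *m (odd_ext R n ^t d *m x) = odd_ext R n ^t d *m (BD *m x).
Proof.
move=> [-> BPrange].
have [|y Ey] := BPrange (odd_ext R n ^t d *m x); first by exists x.
rewrite -!mulmxA Ey (mulmxA (odd_restr R n ^t d)) mulmxA !ntensmx_mul.
by rewrite odd_restr_ext mulmx1.
Qed.

Theorem theorem3p1 (R : realType) (d n : nat) (c : R)
    (hd : (1 <= d)%N) (hn : (1 <= n)%N) (hc : 0 < c)
    (BD : 'M[R]_(n.-1 ^ d)) (BP : 'M[R]_((2 * n) ^ d))
    (hB : LFA_compatible n d BD BP)
    (f : 'cV[R]_(n.-1 ^ d)) (ft : 'cV[R]_((2 * n) ^ d))
    (hft : ft = odd_ext R n ^t d *m f)
    (u : nat -> 'cV[R]_(n.-1 ^ d)) (ut : nat -> 'cV[R]_((2 * n) ^ d))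
    (hu : forall k : nat, u k.+1 = u k + BD *m (f - A_D n d c *m u k))
    (hut : forall k : nat, ut k.+1 = ut k + BP *m (ft - A_P n d c *m ut k))
    (h0 : ut 0%N = odd_ext R n ^t d *m u 0%N) :
  forall k : nat, (1 <= k)%N -> ut k = odd_ext R n ^t d *m u k.
Proof.
move=> k _; elim: k => [//|k IHk].
(* The periodic residual becomes the extension of the Dirichlet residual, to which compatibility
   applies. *)
rewrite hut hu IHk hft /A_P mulmxA (kron_sum_intertwine d c (T_P_odd_ext R n)).
by rewrite -mulmxA -mulmxBr (LFA_compatible_intertwine _ hB) -mulmxDr.
Qed.
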